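(* The logic $\mathsf{S4I}$ has the finite model property: for every formula $\varphi$, if $\mathsf{S4I}\nvdash\varphi$, then there is an $\mathsf{S4I}$-model $\mathcal M$ with finitely many worlds such that $\mathcal M\not\models\varphi$.
   Context: Fix a countably infinite set $\mathbb P$ of propositional variables. Formulas: $\varphi,\psi ::= p\mid\bot\mid(\varphi\wedge\psi)\mid(\varphi\vee\psi)\mid(\varphi\to\psi)\mid\Diamond\varphi\mid\Box\varphi$; $\neg\varphi:=\varphi\to\bot$. A bi-intuitionistic frame is $(W,W_\bot,\preccurlyeq,\sqsubseteq)$ with $\preccurlyeq,\sqsubseteq$ preorders on $W$ and $W_\bot\subseteq W$ upward closed under both; infallible if $W_\bot=\varnothing$. A valuation $V:\mathbb P\to 2^W$ has each $V(p)$ upward closed under $\preccurlyeq$ and containing $W_\bot$; a model is $\mathcal M=(W,W_\bot,\preccurlyeq,\sqsubseteq,V)$. Satisfaction: $p$ iff $w\in V(p)$; $\bot$ iff $w\in W_\bot$; $\wedge,\vee$ pointwise; $w\models\varphi\to\psi$ iff for all $v\succcurlyeq w$, $v\models\varphi$ implies $v\models\psi$; $w\models\Diamond\varphi$ iff for all $u\succcurlyeq w$ there is $v\sqsupseteq u$ with $v\models\varphi$; $w\models\Box\varphi$ iff $v\models\varphi$ whenever $w\preccurlyeq u\sqsubseteq v$. $\mathcal M\models\varphi$ iff $\varphi$ holds at every $w\in W\setminus W_\bot$. $\sqsubseteq$ is forward confluent if $w\preccurlyeq w'$ and $w\sqsubseteq v$ imply some $v'$ with $v\preccurlyeq v'$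 and $w'\sqsubseteq v'$; downward confluent if $w\preccurlyeq v\sqsubseteq v'$ implies some $w'$ with $w\sqsubseteq w'\preccurlyeq v'$. An $\mathsf{S4I}$-frame is an infallible bi-intuitionistic frame in which $\sqsubseteq$ is forward and downward confluent; an $\mathsf{S4I}$-model is a model on such a frame. $\mathsf{CS4}$ is the least set of formulas containing all intuitionistic propositional tautologies and all instances of $\Box(\varphi\to\psi)\to(\Box\varphi\to\Box\psi)$, $\Box(\varphi\to\psi)\to(\Diamond\varphi\to\Diamond\psi)$, $\Box\varphi\to\varphi$, $\varphi\to\Diamond\varphi$, $\Box\varphi\to\Box\Box\varphi$, $\Diamond\Diamond\varphi\to\Diamond\varphi$, closed under modus ponens and necessitation. $\mathsf{S4I}$ is $\mathsf{CS4}$ extended with all instances of $\Diamond(\varphi\vee\psi)\to\Diamond\varphi\vee\Diamond\psi$, $\neg\Diamond\bot$, and $\Box(\varphi\vee\psi)\to\Box\varphi\vee\Diamond\psi$ (closed under the same rules). *)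

(* Defs.v *)
From Stdlib Require Import List.

Inductive form : Type :=
| Var : nat -> form
| Bot : form
| And : form -> form -> form
| Or  : form -> form -> form
| Imp : form -> form -> form
| Dia : form -> form
| Box : form -> form.

Definition Neg (f : form) : form := Imp f Bot.

Fixpoint modal_free (f : form) : Prop :=
  match f with
  | Var _ | Bot => True
  | And a b | Or a b | Imp a b => modal_free a /\ modal_free b
  | Dia _ | Box _ => False
  end.

Fixpoint subst (s : nat -> form) (f : form) : form :=
  match f with
  | Var p => s p
  | Bot => Bot
  | And a b => And (subst s a) (subst s b)
  | Or a b => Or (subst s a) (subst s b)
  | Imp a b => Imp (subst s a) (subst s b)
  | Dia a => Dia (subst s a)
  | Box a => Box (subst s a)
  end.

Inductive IPC : form -> Prop :=
| ipc_k  a b : modal_free a -> modal_free b -> IPC (Imp a (Imp b a))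
| ipc_s  a b c : modal_free a -> modal_free b -> modal_free c ->
    IPC (Imp (Imp a (Imp b c)) (Imp (Imp a b) (Imp a c)))
| ipc_ai a b : modal_free a -> modal_free b -> IPC (Imp a (Imp b (And a b)))
| ipc_ae1 a b : modal_free a -> modal_free b -> IPC (Imp (And a b) a)
| ipc_ae2 a b : modal_free a -> modal_free b -> IPC (Imp (And a b) b)
| ipc_oi1 a b : modal_free a -> modal_free b -> IPC (Imp a (Or a b))
| ipc_oi2 a b : modal_free a -> modal_free b -> IPC (Imp b (Or a b))
| ipc_oe a b c : modal_free a -> modal_free b -> modal_free c ->
    IPC (Imp (Imp a c) (Imp (Imp b c) (Imp (Or a b) c)))
| ipc_efq a : modal_free a -> IPC (Imp Bot a)
| ipc_mp a b : IPC (Imp a b) -> IPC a -> IPC b.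

Definition ipc_taut (f : form) : Prop :=
  exists g s, IPC g /\ f = subst s g.

Inductive CS4 : form -> Prop :=
| cs4_taut f : ipc_taut f -> CS4 f
| cs4_K a b : CS4 (Imp (Box (Imp a b)) (Imp (Box a) (Box b)))
| cs4_Kd a b : CS4 (Imp (Box (Imp a b)) (Imp (Dia a) (Dia b)))
| cs4_T a : CS4 (Imp (Box a) a)
| cs4_Td a : CS4 (Imp a (Dia a))
| cs4_4 a : CS4 (Imp (Box a) (Box (Box a)))
| cs4_4d a : CS4 (Imp (Dia (Dia a)) (Dia a))
| cs4_mp a b : CS4 (Imp a b) -> CS4 a -> CS4 b
| cs4_nec a : CS4 a -> CS4 (Box a).

Inductive S4I : form -> Prop :=
| s4i_taut f : ipc_taut f -> S4I f
| s4i_K a b : S4I (Imp (Box (Imp a b)) (Imp (Box a) (Box b)))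
| s4i_Kd a b : S4I (Imp (Box (Imp a b)) (Imp (Dia a) (Dia b)))
| s4i_T a : S4I (Imp (Box a) a)
| s4i_Td a : S4I (Imp a (Dia a))
| s4i_4 a : S4I (Imp (Box a) (Box (Box a)))
| s4i_4d a : S4I (Imp (Dia (Dia a)) (Dia a))
| s4i_Cd a b : S4I (Imp (Dia (Or a b)) (Or (Dia a) (Dia b)))
| s4i_Nd : S4I (Neg (Dia Bot))
| s4i_FS a b : S4I (Imp (Box (Or a b)) (Or (Box a) (Dia b)))
| s4i_mp a b : S4I (Imp a b) -> S4I a -> S4I b
| s4i_nec a : S4I a -> S4I (Box a).

Record model : Type := {
  W : Type;
  Wbot : W -> Prop;
  le : W -> W -> Prop;
  sq : W -> W -> Prop;
  V : nat -> W -> Prop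
}.

Definition preorder {T : Type} (R : T -> T -> Prop) : Prop :=
  (forall x, R x x) /\ (forall x y z, R x y -> R y z -> R x z).

Definition is_bi_model (M : model) : Prop :=
  preorder (le M) /\ preorder (sq M) /\
  (forall w v, Wbot M w -> le M w v -> Wbot M v) /\
  (forall w v, Wbot M w -> sq M w v -> Wbot M v) /\
  (forall p w v, V M p w -> le M w v -> V M p v) /\
  (forall p w, Wbot M w -> V M p w).

Definition infallible (M : model) : Prop := forall w, ~ Wbot M w.

Definition forward_confluent (M : model) : Prop :=
  forall w w' v, le M w w' -> sq M w v ->
    exists v', le M v v' /\ sq M w' v'.

Definition downward_confluent (M : model) : Prop :=
  forall w v v', le M w v -> sq M v v' ->
    exists w', sq M w w' /\ le M w' v'.

Definition S4I_model (M : model) : Prop :=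
  is_bi_model M /\ infallible M /\ forward_confluent M /\ downward_confluent M.

Fixpoint sat (M : model) (w : W M) (f : form) : Prop :=
  match f with
  | Var p => V M p w
  | Bot => Wbot M w
  | And a b => sat M w a /\ sat M w b
  | Or a b => sat M w a \/ sat M w b
  | Imp a b => forall v, le M w v -> sat M v a -> sat M v b
  | Dia a => forall u, le M w u -> exists v, sq M u v /\ sat M v a
  | Box a => forall u v, le M w u -> sq M u v -> sat M v a
  end.

Definition valid (M : model) (f : form) : Prop :=
  forall w, ~ Wbot M w -> sat M w f.

Definition finite_worlds (M : model) : Prop :=
  exists l : list (W M), forall w, In w l.

(* Main.v *)
(* Completeness for possibly infinite models comes from the canonical model on
   prime theories, with [w] related to [v] when [v] contains every [a] with
   [Box a] in [w], and [w] contains [Dia a] for every [a] in [v].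

   An arbitrary S4I-model is then made finite as follows.  Label each world by
   the subformulas of phi true there, and write [w < v] when [w] is below [v] in
   the intuitionistic order and their labels differ.  The worlds of the new model
   are chains [w_0 < ... < w_k], ordered by extension; their length is bounded
   because labels grow strictly.  A chain sees another one if every [w_i] can be
   moved along the modal relation to some [v_i], the [v_i] being ascending, so
   that the second chain is what is left of the [v_i] after dropping those with
   the label of their predecessor.  Both confluence properties survive this
   dropping, as well as passing to the transitive closure; and the modal formulas
   of the label of the last world are still monotone along it.  Finally each
   [w_i] is replaced by the tree of labels of the chains that start at it: there
   are finitely many such trees, and two chains with the same trees have the
   same extensions, which keeps forward confluence. *)
From HB Require Import structures.
From mathcomp Require Import all_boot.
From mathcomp Require Import boolp.
From Stdlib Require Import Relation_Operators.
Require Import Defs.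

Set Implicit Arguments.
Unset Strict Implicit.
Unset Printing Implicit Defensive.

(** * Intuitionistic axioms as substitution instances *)

Definition subst3 (a b c : form) (n : nat) : form :=
  match n with 0 => a | 1 => b | _ => c end.

Lemma s4i_k a b : S4I (Imp a (Imp b a)).
Proof.
apply: s4i_taut.
by exists (Imp (Var 0) (Imp (Var 1) (Var 0))), (subst3 a b Bot); split=> //; apply: ipc_k.
Qed.

Lemma s4i_s a b c : S4I (Imp (Imp a (Imp b c)) (Imp (Imp a b) (Imp a c))).
Proof.
apply: s4i_taut; exists (Imp (Imp (Var 0) (Imp (Var 1) (Var 2)))
  (Imp (Imp (Var 0) (Var 1)) (Imp (Var 0) (Var 2)))), (subst3 a b c).
by split=> //; apply: ipc_s.
Qed.

Lemma s4i_ai a b : S4I (Imp a (Imp b (And a b))).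
Proof.
apply: s4i_taut; exists (Imp (Var 0) (Imp (Var 1) (And (Var 0) (Var 1)))), (subst3 a b Bot).
by split=> //; apply: ipc_ai.
Qed.

Lemma s4i_ae1 a b : S4I (Imp (And a b) a).
Proof.
apply: s4i_taut; exists (Imp (And (Var 0) (Var 1)) (Var 0)), (subst3 a b Bot).
by split=> //; apply: ipc_ae1.
Qed.

Lemma s4i_ae2 a b : S4I (Imp (And a b) b).
Proof.
apply: s4i_taut; exists (Imp (And (Var 0) (Var 1)) (Var 1)), (subst3 a b Bot).
by split=> //; apply: ipc_ae2.
Qed.

Lemma s4i_oi1 a b : S4I (Imp a (Or a b)).
Proof.
apply: s4i_taut; exists (Imp (Var 0) (Or (Var 0) (Var 1))), (subst3 a b Bot).
by split=> //; apply: ipc_oi1.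
Qed.

Lemma s4i_oi2 a b : S4I (Imp b (Or a b)).
Proof.
apply: s4i_taut; exists (Imp (Var 1) (Or (Var 0) (Var 1))), (subst3 a b Bot).
by split=> //; apply: ipc_oi2.
Qed.

Lemma s4i_oe a b c : S4I (Imp (Imp a c) (Imp (Imp b c) (Imp (Or a b) c))).
Proof.
apply: s4i_taut; exists (Imp (Imp (Var 0) (Var 2)) (Imp (Imp (Var 1) (Var 2))
  (Imp (Or (Var 0) (Var 1)) (Var 2)))), (subst3 a b c).
by split=> //; apply: ipc_oe.
Qed.

Lemma s4i_efq a : S4I (Imp Bot a).
Proof.
apply: s4i_taut; exists (Imp Bot (Var 0)), (subst3 a Bot Bot).
by split=> //; apply: ipc_efq.
Qed.

(** * Theories, ideals and prime theories *)

Definition theory (T : form -> Prop) : Prop :=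
  (forall a, S4I a -> T a) /\ (forall a b, T (Imp a b) -> T a -> T b).

Definition ideal (I : form -> Prop) : Prop :=
  [/\ I Bot, forall a b, I a -> I b -> I (Or a b)
    & forall a b, S4I (Imp a b) -> I b -> I a].

Definition prime_theory (T : form -> Prop) : Prop :=
  [/\ theory T, ~ T Bot & forall a b, T (Or a b) -> T a \/ T b].

Lemma theory_S4I : theory S4I.
Proof. by split=> // a b; apply: s4i_mp. Qed.

Lemma theory_thm T a b : theory T -> S4I (Imp a b) -> T a -> T b.
Proof. by move=> [T0 T1] h; apply: T1; apply: T0. Qed.

Lemma theory_ext T a : theory T -> theory (fun x => T (Imp a x)).
Proof.
move=> thT; have [T0 T1] := thT; split=> [x hx|x y hxy].
  by apply: theory_thm (s4i_k _ _) _ => //; apply: T0.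
by apply: T1; apply: theory_thm (s4i_s _ _ _) _.
Qed.

Lemma theory_extS T a x : theory T -> T x -> T (Imp a x).
Proof. by move=> thT; apply: theory_thm (s4i_k _ _). Qed.

Lemma theory_imp_refl T a : theory T -> T (Imp a a).
Proof.
move=> [T0 T1]; apply: (T1 _ _ _ (T0 _ (s4i_k a a))).
exact: T1 (T0 _ (s4i_s _ _ _)) (T0 _ (s4i_k a (Imp a a))).
Qed.

(** The premise is applied to the extension [fun x => T (Imp a x)]; theories are closed under modus
    ponens only, so this is one. *)
Lemma deduction T a b : theory T ->
  (forall T', theory T' -> (forall x, T x -> T' x) -> T' a -> T' b) -> T (Imp a b).
Proof.
move=> thT /(_ (fun x => T (Imp a x))); apply; first exact: theory_ext.
  by move=> x; apply: theory_extS.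
exact: theory_imp_refl.
Qed.

Lemma theory_and T a b : theory T -> T (And a b) <-> T a /\ T b.
Proof.
move=> thT; split=> [h|[ha hb]].
  by split; [apply: theory_thm (s4i_ae1 a b) _ | apply: theory_thm (s4i_ae2 a b) _].
by apply: thT.2 hb; apply: theory_thm (s4i_ai a b) _.
Qed.

Lemma theory_orl T a b : theory T -> T a -> T (Or a b).
Proof. by move=> thT; apply: theory_thm (s4i_oi1 _ _). Qed.

Lemma theory_orr T a b : theory T -> T b -> T (Or a b).
Proof. by move=> thT; apply: theory_thm (s4i_oi2 _ _). Qed.

Lemma theory_or_elim T a b c : theory T ->
  T (Or a b) -> T (Imp a c) -> T (Imp b c) -> T c.
Proof.
move=> [T0 T1] hab ha hb.
by apply: (T1 _ _ _ hab); apply: (T1 _ _ _ hb); apply: (T1 _ _ _ ha); apply: T0; apply: s4i_oe.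
Qed.

Lemma imp_trans T a b c : theory T -> T (Imp a b) -> T (Imp b c) -> T (Imp a c).
Proof.
move=> thT hab hbc; apply: deduction => // T' [_ T1] sub ha.
exact: T1 (sub _ hbc) (T1 _ _ (sub _ hab) ha).
Qed.

Lemma box_mono a b : S4I (Imp a b) -> S4I (Imp (Box a) (Box b)).
Proof. by move=> h; exact: s4i_mp (s4i_K _ _) (s4i_nec _ h). Qed.

Lemma dia_mono a b : S4I (Imp a b) -> S4I (Imp (Dia a) (Dia b)).
Proof. by move=> h; exact: s4i_mp (s4i_Kd _ _) (s4i_nec _ h). Qed.

(** * Enumeration of formulas *)

Fixpoint tree_of_form (f : form) : GenTree.tree nat :=
  match f with
  | Var p => GenTree.Leaf p
  | Bot => GenTree.Node 0 [::]
  | And a b => GenTree.Node 1 [:: tree_of_form a; tree_of_form b]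
  | Or a b => GenTree.Node 2 [:: tree_of_form a; tree_of_form b]
  | Imp a b => GenTree.Node 3 [:: tree_of_form a; tree_of_form b]
  | Dia a => GenTree.Node 4 [:: tree_of_form a]
  | Box a => GenTree.Node 5 [:: tree_of_form a]
  end.

Fixpoint form_of_tree (t : GenTree.tree nat) : form :=
  match t with
  | GenTree.Leaf p => Var p
  | GenTree.Node 1 [:: a; b] => And (form_of_tree a) (form_of_tree b)
  | GenTree.Node 2 [:: a; b] => Or (form_of_tree a) (form_of_tree b)
  | GenTree.Node 3 [:: a; b] => Imp (form_of_tree a) (form_of_tree b)
  | GenTree.Node 4 [:: a] => Dia (form_of_tree a)
  | GenTree.Node 5 [:: a] => Box (form_of_tree a)
  | _ => Bot
  end.

Lemma tree_of_formK : cancel tree_of_form form_of_tree.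
Proof. by elim=> //= [a -> b ->|a -> b ->|a -> b ->|a ->|a ->]. Qed.

HB.instance Definition _ := Equality.copy form (can_type tree_of_formK).

Definition nth_form (n : nat) : form :=
  if unpickle n is Some t then form_of_tree t else Bot.

Lemma nth_form_surj a : exists n, nth_form n = a.
Proof.
by exists (pickle (tree_of_form a)); rewrite /nth_form pickleK tree_of_formK.
Qed.

(** * Separation of a theory from an ideal *)

Section Lindenbaum.

Variables T I : form -> Prop.
Hypotheses (thT : theory T) (idI : ideal I) (disjTI : forall x, T x -> ~ I x).

(** The test that adding the next formula keeps the theory off [I] is a conjunct of the proposition,
    so the recursion makes no case distinction. *)
Fixpoint stage (n : nat) (x : form) : Prop :=
  match n with
  | 0 => T x
  | n.+1 => stage n x \/
      ((forall y, stage n (Imp (nth_form n) y) -> ~ I y) /\ stage n (Imp (nth_form n) x))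
  end.

Definition stage_limit (x : form) : Prop := exists n, stage n x.

Lemma stage_mono m n x : m <= n -> stage m x -> stage n x.
Proof.
move=> /subnK <-; elim: (n - m) => [|k IH] //= h.
by left; apply: IH.
Qed.

Lemma stage_theory n : theory (stage n).
Proof.
elim: n => [|n IH] //=; have [T0 T1] := theory_ext (nth_form n) IH.
split=> [a ha|a b [hab|[C hab]] [ha|[C' ha]]]; first by left; apply: IH.1.
- by left; apply: IH.2 hab ha.
- by right; split=> //; apply: T1 ha; apply: theory_extS.
- by right; split=> //; apply: T1 hab _; apply: theory_extS.
- by right; split=> //; apply: T1 hab ha.
Qed.

Lemma stage_disjoint n x : stage n x -> ~ I x.
Proof.
elim: n x => [|n IH] x /=; first exact: disjTI.
by case=> [|[C hx]]; [apply: IH | apply: C].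
Qed.

Lemma stage_limit_theory : theory stage_limit.
Proof.
split=> [a ha|a b [m hm] [n hn]]; first by exists 0; apply: (stage_theory 0).1.
exists (maxn m n); apply: (stage_theory _).2.
  by apply: stage_mono hm; rewrite leq_maxl.
by apply: stage_mono hn; rewrite leq_maxr.
Qed.

Lemma stage_limit_maximal a :
  stage_limit a \/ exists2 y, stage_limit (Imp a y) & I y.
Proof.
have [n <-] := nth_form_surj a.
have [[y [hy Iy]]|C] := pselect (exists y, stage n (Imp (nth_form n) y) /\ I y).
  by right; exists y => //; exists n.
left; exists n.+1; right; split; last exact: theory_imp_refl (stage_theory n).
by move=> y hy Iy; apply: C; exists y.
Qed.

Lemma stage_limit_prime : prime_theory stage_limit.
Proof.
have [I0 I1 I2] := idI; have thL := stage_limit_theory.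
split=> [//|[n]|a b hab]; first by move/stage_disjoint.
case: (stage_limit_maximal a) => [|[x hx Ix]]; first by left.
case: (stage_limit_maximal b) => [|[y hy Iy]]; first by right.
(* With both disjuncts missing, each implies an element of [I], so the limit would contain a
   disjunction that lies in [I]. *)
have [n /stage_disjoint[]] : stage_limit (Or x y); last exact: I1.
apply: (theory_or_elim thL hab).
  by apply: imp_trans hx _ => //; apply: thL.1; apply: s4i_oi1.
by apply: imp_trans hy _ => //; apply: thL.1; apply: s4i_oi2.
Qed.

Lemma prime_separation :
  exists P, [/\ prime_theory P, forall x, T x -> P x & forall x, P x -> ~ I x].
Proof.
exists stage_limit; split; first exact: stage_limit_prime.
  by move=> x hx; exists 0.
by move=> x [n]; apply: stage_disjoint.
Qed.

End Lindenbaum.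

Lemma principal_ideal b : ideal (fun x => S4I (Imp x b)).
Proof.
split=> [|x y hx hy|x y hxy hy]; first exact: s4i_efq.
  apply: deduction theory_S4I _ => T thT sub h.
  by apply: theory_or_elim h _ _ => //; apply: sub.
exact: imp_trans theory_S4I hxy hy.
Qed.

(** * The canonical model *)

Definition modal_rel (w v : form -> Prop) : Prop :=
  (forall a, w (Box a) -> v a) /\ (forall a, v a -> w (Dia a)).

Lemma box_inv_theory w : theory w -> theory (fun a => w (Box a)).
Proof.
move=> thw; split=> [a ha|a b hab].
  by apply: thw.1; apply: s4i_nec.
by apply: thw.2; apply: theory_thm (s4i_K _ _) _.
Qed.

Lemma dia_inv_ideal w : prime_theory w -> ideal (fun a => ~ w (Dia a)).
Proof.
move=> [thw nBot por]; split.
- by move=> h; apply: nBot; apply: theory_thm s4i_Nd h.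
- by move=> a b ha hb /(theory_thm thw (s4i_Cd a b))/por[].
- by move=> a b hab hb ha; apply: hb; apply: theory_thm (dia_mono hab) ha.
Qed.

(** [G] is the theory generated by [F] and the formulas boxed in [w]. By [s4i_Kd] it avoids the
    ideal of formulas whose diamond is not in [w], and a prime theory separating the two is the
    successor. *)
Lemma dia_successor w F : prime_theory w -> theory F -> (forall f, F f -> w (Dia f)) ->
  exists v, [/\ prime_theory v, modal_rel w v & forall x, F x -> v x].
Proof.
move=> pw thF Fw; have [thw _ _] := pw.
have thB := box_inv_theory thw.
pose G x := exists2 f, F f & w (Box (Imp f x)).
have FG x : F x -> G x by exists x => //; apply: theory_imp_refl thB.
have BG x : w (Box x) -> G x.
  move=> hx; exists (Imp Bot Bot); first exact: theory_imp_refl.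
  exact: (theory_extS _ thB).
have thG : theory G.
  split=> [a ha|a b [f Ff hf] [g Fg hg]]; first by apply: FG; apply: thF.1.
  exists (And f g); first exact/theory_and.
  apply: (deduction thB) => U thU sub /(theory_and _ _ thU)[Uf Ug].
  by apply: (thU.2 a); [apply: thU.2 Uf | apply: thU.2 Ug]; apply: sub.
have [|v [pv Gv Nv]] := prime_separation thG (dia_inv_ideal pw).
  by move=> x [f /Fw hf hx]; apply; apply: thw.2 hf; apply: theory_thm (s4i_Kd _ _) hx.
exists v; split=> // [|x /FG/Gv //].
by split=> [a /BG/Gv //|a /Nv/contrapT].
Qed.

(** Dual to [dia_successor]: [K] is the ideal generated by [J] and the formulas whose diamond is not
    in [w]. It misses the formulas boxed in [w] because [s4i_FS] turns [Box (Or i n)] into [Box i]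
    or [Dia n]. *)
Lemma box_successor w J : prime_theory w -> ideal J -> (forall i, J i -> ~ w (Box i)) ->
  exists v, [/\ prime_theory v, modal_rel w v & forall x, v x -> ~ J x].
Proof.
move=> pw idJ Jw; have [thw _ por] := pw; have [J0 J1 J2] := idJ.
have [N0 N1 N2] := dia_inv_ideal pw.
pose K x := exists i n, [/\ J i, ~ w (Dia n) & S4I (Imp x (Or i n))].
have JK x : J x -> K x by exists x, Bot; split=> //; apply: s4i_oi1.
have NK x : ~ w (Dia x) -> K x by exists Bot, x; split=> //; apply: s4i_oi2.
have idK : ideal K.
  split; first exact: JK.
    move=> a b [i [n [Ji Nn h]]] [j [m [Jj Nm k]]].
    exists (Or i j), (Or n m); split; [exact: J1 | exact: N1 |].
    apply: deduction theory_S4I _ => T thT sub hab.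
    apply: (theory_or_elim thT hab); apply: deduction => // U thU subU hU.
      apply: (theory_or_elim thU (theory_thm thU h hU)); apply: deduction => // X thX _ hX.
        by apply: theory_orl => //; apply: theory_orl.
      by apply: theory_orr => //; apply: theory_orl.
    apply: (theory_or_elim thU (theory_thm thU k hU)); apply: deduction => // X thX _ hX.
      by apply: theory_orl => //; apply: theory_orr.
    by apply: theory_orr => //; apply: theory_orr.
  move=> a b hab [i [n [Ji Nn h]]]; exists i, n; split=> //.
  exact: imp_trans theory_S4I hab h.
have [|v [pv Bv Kv]] := prime_separation (box_inv_theory thw) idK.
  move=> x hx [i [n [Ji Nn h]]].
  have /(theory_thm thw (s4i_FS i n))/por[|//] := theory_thm thw (box_mono h) hx.
  exact: Jw.
exists v; split=> // [|x /Kv hx /JK //].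
by split=> // a /Kv ha; apply: contrapT => /NK.
Qed.

Definition canonical_model : model :=
  {| W := {w : form -> Prop | prime_theory w};
     Wbot := fun _ => False;
     le := fun w v => forall x, sval w x -> sval v x;
     sq := fun w v => modal_rel (sval w) (sval v);
     V := fun p w => sval w (Var p) |}.

Lemma canonical_S4I : S4I_model canonical_model.
Proof.
split; last split; [|by move=> w []|split].
- split; first by split=> [w x|x y z xy yz a /xy/yz].
  split; last by do ?split=> //; move=> p w v h; apply.
  split=> [[w [thw nw ow]]|[w [thw nw ow]] v u [] /= b1 d1 [b2 d2]]; split=> a /=.
  + exact: theory_thm (s4i_T a).
  + exact: theory_thm (s4i_Td a).
  + by move=> /(theory_thm thw (s4i_4 a))/b1/b2.
  + by move=> /d2/d1; apply: theory_thm (s4i_4d a).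
- move=> [w pw] [w' pw'] [v pv] /= ww' [bx di].
  (* Diamonds of members of [v] lie in [w], hence in [w']. *)
  have [|f hf|v' [pv' r vv']] := @dia_successor w' v pw'; first by case: pv.
    exact/ww'/di.
  by exists (exist _ v' pv').
- move=> [w pw] [v pv] [v' pv'] /= wv [bx di].
  have [thv' nv' ov'] := pv'.
  (* The complement of [v'] is an ideal since [v'] is prime; a successor avoiding it lies below
     [v']. *)
  have [||w' [pw' r wv']] := @box_successor w (fun x => ~ v' x) pw.
  + split=> // [a b ha hb /ov'[]//|a b hab hb ha].
    by apply: hb; apply: theory_thm hab ha.
  + by move=> i hi /wv/bx.
  by exists (exist _ w' pw'); split=> // x /wv'/contrapT.
Qed.

Lemma canonical_truth a (w : W canonical_model) : sat canonical_model w a <-> sval w a.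
Proof.
elim: a w => [p||a IHa b IHb|a IHa b IHb|a IHa b IHb|a IHa|a IHa] [w pw] //=;
  have [thw nw ow] := pw.
- by split.
- by rewrite (theory_and _ _ thw) IHa IHb.
- rewrite IHa IHb /=; split=> [[]|/ow //]; first exact: theory_orl.
  exact: theory_orr.
- split=> [h|h [v [thv nv ov]] /= wv]; last first.
    by rewrite IHa IHb /=; apply: thv.2; apply: wv.
  apply: contrapT => nab.
  have [|v [pv wv vb]] := prime_separation (theory_ext a thw) (principal_ideal b).
    by move=> x hx hxb; apply: nab; apply: imp_trans hx _ => //; apply: thw.1.
  have thv : theory v by case: pv.
  have /IHb/= vb' : sat canonical_model (exist _ v pv) b.
    apply: h => [x hx /=|]; first by apply: wv; apply: (theory_extS _ thw).
    by rewrite IHa /=; apply: wv; apply: (theory_imp_refl _ thw).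
  by apply: vb vb' _; apply: theory_imp_refl theory_S4I.
- split=> [h|h [v pv] /= wv].
    have [[v pv] /= [[_ di] /IHa/= va]] := h (exist _ w pw) (fun x hx => hx).
    exact: di.
  have [|f hf|u [pu r au]] := @dia_successor v (fun x => S4I (Imp a x)) pv.
  + exact: theory_ext theory_S4I.
  + by have [thv _ _] := pv; apply: theory_thm (dia_mono hf) _ => //; apply: wv.
  exists (exist _ u pu); split=> //; rewrite IHa /=; apply: au.
  exact: theory_imp_refl theory_S4I.
- split=> [h|h [v pv] [u pu] /= wv [bx _]]; last by rewrite IHa /=; apply/bx/wv.
  apply: contrapT => nba.
  have [i hi hb|u [pu r ua]] := @box_successor w _ pw (principal_ideal a).
    by apply: nba; apply: theory_thm (box_mono hi) hb.
  have /IHa/ua[] := h (exist _ w pw) (exist _ u pu) (fun x hx => hx) r.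
  exact: theory_imp_refl theory_S4I.
Qed.

Lemma S4I_complete phi : ~ S4I phi -> exists M, S4I_model M /\ ~ valid M phi.
Proof.
move=> nphi; exists canonical_model; split; first exact: canonical_S4I.
have [x hx hxp|w [pw _ wphi]] := prime_separation theory_S4I (principal_ideal phi).
  by apply: nphi; apply: s4i_mp hxp hx.
move=> /(_ (exist _ w pw) (fun h => h))/canonical_truth/wphi.
by apply; apply: theory_imp_refl theory_S4I.
Qed.

(** * Finite quotients of models *)

Lemma sat_persistent M a w v : is_bi_model M -> le M w v -> sat M w a -> sat M v a.
Proof.
move=> [[lexx le_trans] [_ [Wbot_le [_ [V_le _]]]]].
elim: a w v => [p||a IHa b IHb|a IHa b IHb|a IHa b IHb|a IHa|a IHa] w v wv /=.
- by move=> h; apply: V_le wv.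
- by move=> h; apply: Wbot_le wv.
- by move=> [/IHa-/(_ _ wv) ? /IHb-/(_ _ wv)].
- by move=> [/IHa-/(_ _ wv)|/IHb-/(_ _ wv)]; [left|right].
- by move=> h u vu; apply: h; apply: le_trans vu.
- by move=> h u vu; apply: h; apply: le_trans vu.
- by move=> h u x vu; apply: h; apply: le_trans vu.
Qed.

(** Forward confluence lifts a witness at [w] to every world above [w]; downward confluence plays
    this part for [Box]. *)
Lemma sat_Dia M a w : S4I_model M ->
  sat M w (Dia a) <-> exists2 v, sq M w v & sat M v a.
Proof.
move=> [biM [_ [fwd _]]]; have [[lexx _] _] := biM.
split=> [/(_ w (lexx w))[v [wv va]]|[v wv va] u wu]; first by exists v.
have [v' [vv' uv']] := fwd _ _ _ wu wv.
by exists v'; split=> //; apply: sat_persistent va.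
Qed.

Lemma sat_Box M a w : S4I_model M ->
  sat M w (Box a) <-> forall v, sq M w v -> sat M v a.
Proof.
move=> [biM [_ [_ dwn]]]; have [[lexx _] _] := biM.
split=> [h v|h u v wu uv]; first exact: h.
have [w' [ww' w'v]] := dwn _ _ _ wu uv.
by apply: sat_persistent w'v (h _ ww').
Qed.

(** * Subformula closure *)

Fixpoint subforms (f : form) : seq form :=
  f :: match f with
       | Var _ | Bot => [::]
       | And a b | Or a b | Imp a b => subforms a ++ subforms b
       | Dia a | Box a => subforms a
       end.

Definition subform_closed (S : seq form) : Prop :=
  forall f, f \in S ->
    match f with
    | Var _ | Bot => True
    | And a b | Or a b | Imp a b => a \in S /\ b \in S
    | Dia a | Box a => a \in S
    end.

Lemma subforms_refl f : f \in subforms f.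
Proof. by case: f => *; rewrite inE eqxx. Qed.

Lemma subforms_trans f g h :
  f \in subforms g -> g \in subforms h -> f \in subforms h.
Proof.
move=> fg; elim: h => [p||a IHa b IHb|a IHa b IHb|a IHa b IHb|a IHa|a IHa] /=;
  rewrite in_cons => /orP[/eqP gE|]; rewrite ?gE // in fg *; rewrite in_cons ?mem_cat.
all: by [case/orP=> [/IHa|/IHb] ->; rewrite ?orbT | move/IHa->; rewrite orbT].
Qed.

Lemma subforms_closed phi : subform_closed (subforms phi).
Proof.
move=> f fphi.
by case: f fphi => //= [a b|a b|a b|a|a] fphi; try split; apply: subforms_trans fphi;
  rewrite /= inE ?mem_cat subforms_refl ?orbT.
Qed.

(** * Labels of worlds and codes of their label trees *)

Section FiniteModel.

Variables (M : model) (Sig : seq form).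
Hypotheses (HM : S4I_model M) (Sig_closed : subform_closed Sig).

Local Notation X := (W M).
Local Notation m := (size Sig).

Lemma leM_refl (w : X) : le M w w.
Proof. by case: HM => [[[h _] _] _]; apply: h. Qed.

Lemma leM_trans (w v u : X) : le M w v -> le M v u -> le M w u.
Proof. by case: HM => [[[_ h] _] _]; apply: h. Qed.

Definition label (w : X) : {set 'I_m} := [set i : 'I_m | `[< sat M w (nth Bot Sig i) >]].

Lemma label_sat w v a : label w = label v -> a \in Sig -> sat M w a -> sat M v a.
Proof.
move=> /setP wv aS; have iS : index a Sig < m by rewrite index_mem.
have := wv (Ordinal iS); rewrite !inE /= nth_index // => e.
exact: (asbool_eq_equiv e).1.
Qed.

Lemma label_le w v : le M w v -> label w \subset label v.
Proof.
move=> wv; apply/subsetP => i; rewrite !inE => /asboolP h; apply/asboolP.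
by case: HM => biM _; apply: sat_persistent h.
Qed.

Definition label_lt (w v : X) : Prop := le M w v /\ label w <> label v.

Lemma lt_card w v : label_lt w v -> #|label w| < #|label v|.
Proof.
move=> [/label_le wv neq]; apply: proper_card.
by rewrite properEneq wv andbT; apply/eqP.
Qed.

(* Truncation at depth [k] of the tree of labels of strict [le]-successors. *)
Fixpoint code (k : nat) : finType :=
  match k with
  | 0 => unit
  | k.+1 => ({set 'I_m} * {set code k})%type
  end.

Fixpoint code_of (k : nat) (w : X) : code k :=
  match k with
  | 0 => tt
  | k.+1 => (label w, [set x | `[< exists2 v, label_lt w v & code_of k v = x >]])
  end.

Lemma code_of_lt k w v w' : code_of k.+1 w = code_of k.+1 v -> label_lt w w' ->
  exists2 v', label_lt v v' & code_of k v' = code_of k w'.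
Proof.
move=> [_ /setP/(_ (code_of k w'))]; rewrite !inE => e ww'.
by apply: (asbool_eq_equiv e).1; exists w'.
Qed.

Lemma code_of_label k w v : code_of k.+1 w = code_of k.+1 v -> label w = label v.
Proof. by case. Qed.

(** Labels grow strictly and have at most [m] elements, so a sequence of strict steps from [w] has
    length at most [m - #|label w|]; a truncation deeper than that already determines the next
    level. *)
Lemma code_of_stable k w v : m - #|label w| < k ->
  code_of k w = code_of k v -> code_of k.+1 w = code_of k.+1 v.
Proof.
elim: k w v => [//|k IH] w v wk wv.
have lE := code_of_label wv.
have half w1 v1 x : m - #|label w1| < k.+1 -> code_of k.+1 w1 = code_of k.+1 v1 ->
    (exists2 u, label_lt w1 u & code_of k.+1 u = x) -> exists2 u, label_lt v1 u & code_of k.+1 u = x.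
  move=> w1k w1v1 [u w1u <-]; have [u' v1u' uu'] := code_of_lt w1v1 w1u.
  exists u' => //; symmetry; apply: IH => //.
  have lu : #|label u| <= m by rewrite -[m in _ <= m]card_ord max_card.
  rewrite -ltnS; apply: leq_trans w1k; rewrite ltnS; apply: ltn_sub2l (lt_card w1u).
  exact: leq_trans (lt_card w1u) lu.
congr pair => //; apply/setP => x; rewrite !inE; apply/asbool_equiv_eq; split; apply: half => //.
by rewrite -lE.
Qed.

Arguments code_of : simpl never.

Local Notation c := (code_of m.+1).
Local Notation C := (code m.+1).

(** Depth [m.+1] is above the bound of [code_of_stable] for every [w], so successors are matched at
    full depth, not one level lower. *)
Lemma c_lt w v w' : c w = c v -> label_lt w w' -> exists2 v', label_lt v v' & c v' = c w'.
Proof.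
move=> wv; have := code_of_lt (code_of_stable _ wv); apply.
by rewrite ltnS leq_subr.
Qed.

(** * Chains and their moves *)

Inductive chain : X -> seq X -> Prop :=
| chain1 w : chain w [:: w]
| chainS w s w' : chain w s -> label_lt w w' -> chain w' (w' :: s).

Lemma chain_head w s : chain w s -> exists s', s = w :: s'.
Proof. by case=> [v|v t v' _ _]; [exists [::] | exists t]. Qed.

Lemma chain_cons w x s : chain w (x :: s) -> s <> [::] ->
  x = w /\ exists2 v, chain v s & label_lt v w.
Proof. by move=> h; inversion h; subst=> // _; split=> //; exists w0. Qed.

Lemma chain_size w s : chain w s -> size s <= m.+1.
Proof.
move=> ws; have : size s <= #|label w|.+1.
  elim: ws => {w s} // w s w' _ IH /lt_card /=.
  by rewrite ltnS => ww'; apply: leq_trans ww'.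
by move/leq_trans; apply; rewrite ltnS -[m in _ <= m]card_ord max_card.
Qed.

Lemma chain_code w s v t : chain w s -> chain v t -> map c s = map c t -> c w = c v.
Proof. by move=> /chain_head[s' ->] /chain_head[t' ->] /(congr1 (head (c w))). Qed.

(** By [c_lt] the steps coded by [p] are copied one by one on top of [s]; hence the possible
    extensions depend only on codes. *)
Lemma chain_extend w s w1 s1 p : chain w s -> chain w1 s1 ->
  map c s1 = p ++ map c s ->
  exists w' q, [/\ chain w' (q ++ s), le M w w' & map c (q ++ s) = map c s1].
Proof.
move=> ws; elim: p w1 s1 => [|x p IH] w1 s1 ws1.
  by move=> ->; exists w, [::]; split=> //; apply: leM_refl.
case: ws1 => {w1 s1} [w1|w1 s1 w2 ws1 w12] /=.
  by have [s' ->] := chain_head ws; case: p {IH}.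
move=> e; have [w' [q [wq ww' Eq]]] := IH _ _ ws1 (congr1 behead e).
have [w2' w'w2' cw2] := c_lt (esym (chain_code wq ws1 Eq)) w12.
exists w2', (w2' :: q); split; first exact: chainS wq _.
  by apply: leM_trans ww' _; case: w'w2'.
by rewrite /= cw2 Eq.
Qed.

(* [chain_move w s v u t]: every world of the chain [s], with last world [w], moves
   along [sq] to an ascending sequence with last world [v]; [t], with last world
   [u], is obtained from it by dropping every world whose label equals that of
   its predecessor.  Chains are listed from their last world down. *)
Inductive chain_move : X -> seq X -> X -> X -> seq X -> Prop :=
| move1 w v : sq M w v -> chain_move w [:: w] v v [:: v]
| move_keep w s v u t w' v' : chain_move w s v u t -> label_lt w w' -> sq M w' v' ->
    le M v v' -> label v <> label v' -> chain_move w' (w' :: s) v' v' (v' :: t)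
| move_drop w s v u t w' v' : chain_move w s v u t -> label_lt w w' -> sq M w' v' ->
    le M v v' -> label v = label v' -> chain_move w' (w' :: s) v' u t.

Lemma move_spec w s v u t : chain_move w s v u t ->
  [/\ chain w s, chain u t, sq M w v, le M u v & label u = label v].
Proof.
elim=> {w s v u t} [w v wv|w s v u t w' v' _ [ws ut wv uv luv] ww' wv' vv' ne|
                    w s v u t w' v' _ [ws ut wv uv luv] ww' wv' vv' e].
- by split=> //; try exact: chain1; apply: leM_refl.
- split=> //; first exact: chainS ws ww'.
    apply: chainS ut _; split; first exact: leM_trans vv'.
    by rewrite luv.
  exact: leM_refl.
- split=> //; first exact: chainS ws ww'.
    exact: leM_trans vv'.
  by rewrite luv.
Qed.

(** Downward confluence pulls the target of the last world back to the earlier worlds, one at a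
    time. *)
Lemma move_total w s v : chain w s -> sq M w v -> exists u t, chain_move w s v u t.
Proof.
move=> ws; elim: ws v => {w s} [w v wv|w s w' ws IH ww' v' wv'].
  by exists v, [:: v]; apply: move1.
case: HM => _ [_ [_ dwn]]; have [v [wv vv']] := dwn _ _ _ ww'.1 wv'.
have [u [t mv]] := IH _ wv.
have [e|ne] := pselect (label v = label v'); first by exists u, t; apply: move_drop mv _ _ _ _.
by exists v', (v' :: t); apply: move_keep mv _ _ _ _.
Qed.

(** Forward confluence continues the move over the new worlds [q]; each of them adds at most one
    world on top of the target. *)
Lemma move_forward w s v u t w' q : chain_move w s v u t -> chain w' (q ++ s) ->
  exists v' u' t', chain_move w' (q ++ s) v' u' t' /\ exists p, t' = p ++ t.
Proof.
move=> mv; have [ws _ _ _ _] := move_spec mv.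
elim: q w' => [|x q IH] w' /= wq.
  have -> : w' = w.
    by have [s' E] := chain_head wq; have [s'' E'] := chain_head ws; rewrite E' in E; case: E.
  by exists v, u, t; split=> //; exists [::].
have [-> [w1 wq1 w1w']] : x = w' /\ exists2 w1, chain w1 (q ++ s) & label_lt w1 w'.
  have [s' Es] := chain_head ws.
  by case/chain_cons: wq => // qs0; exfalso; move: qs0; rewrite Es; case: (q).
have [v1 [u1 [t1 [mv1 st1]]]] := IH _ wq1.
have [_ _ w1v1 _ _] := move_spec mv1.
case: HM => _ [_ [fwd _]]; have [v' [vv' wv']] := fwd _ _ _ w1w'.1 w1v1.
have [e|ne] := pselect (label v1 = label v').
  by exists v', u1, t1; split=> //; apply: move_drop mv1 _ _ _ _.
exists v', v', (v' :: t1); split; first exact: move_keep mv1 _ _ _ _.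
by case: st1 => p ->; exists (v' :: p).
Qed.

(** A move is built from the lowest world up, so its restriction to the lower part [s] is a
    subderivation, whose target is a lower part of [t']. *)
Lemma move_downward w' s' v' u' t' q s : chain_move w' s' v' u' t' -> s' = q ++ s -> s <> [::] ->
  exists w v u t, chain_move w s v u t /\ exists p, t' = p ++ t.
Proof.
move=> mv; elim: mv q => {w' s' v' u' t'}
    [w v wv|w s1 v u t w' v' mv IH ww' wv' vv' ne|w s1 v u t w' v' mv IH ww' wv' vv' e] q.
- case: q => [/= <- _|x [|y q]]; last by [].
    by exists w, v, v, [:: v]; split; [apply: move1 | exists [::]].
  by move=> [_ <-] [].
- case: q => [/= <- _|x q [_ E] s0].
    exists w', v', v', (v' :: t).
    by split; [apply: move_keep mv _ _ _ _ | exists [::]].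
  have [w1 [v1 [u1 [t1 [mv1 st1]]]]] := IH q E s0.
  exists w1, v1, u1, t1; split=> //.
  by case: st1 => p ->; exists (v' :: p).
- case: q => [/= <- _|x q [_ E] s0]; last exact: IH E s0.
  exists w', v', u, t.
  by split; [apply: move_drop mv _ _ _ _ | exists [::]].
Qed.

(** * The finite model on code sequences of chains *)

Definition realized (y : seq C) : Prop := exists w s, chain w s /\ y = map c s.

Definition fworld : finType := {y : {bseq m.+1 of C} | `[< realized y >]}.

Definition fcodes (y : fworld) : seq C := val (val y).

Definition realizes (y : fworld) (w : X) (s : seq X) : Prop :=
  chain w s /\ fcodes y = map c s.

Lemma fworld_realized y : exists w s, realizes y w s.
Proof. by case: y => y h; exact: (asboolW h). Qed.

Lemma fworld_of_chain w s : chain w s -> exists y, realizes y w s.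
Proof.
move=> ws; have sz : size (map c s) <= m.+1 by rewrite size_map (chain_size ws).
have h : `[< realized (Bseq sz) >] by apply/asboolP; exists w, s.
by exists (exist _ (Bseq sz) h); split.
Qed.

Lemma realizes_label y w s v t : realizes y w s -> realizes y v t -> label w = label v.
Proof.
move=> [ws ys] [vt yt]; apply: (@code_of_label m).
by apply: chain_code ws vt _; rewrite -ys.
Qed.

(** New worlds enter a chain at the front of its list. *)
Definition fle (y z : fworld) : Prop := suffix (fcodes y) (fcodes z).

Definition fmove (y z : fworld) : Prop :=
  exists w s v u t, [/\ chain_move w s v u t, fcodes y = map c s & fcodes z = map c t].

(** Successive moves may use different chains for the world between them, hence the closure. The
    valuation asks for some realization; [fle_extend] makes it persistent, also for variables
    outside [Sig]. *)
Definition fmodel : model :=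
  {| W := fworld;
     Wbot := fun _ => False;
     le := fle;
     sq := clos_refl_trans _ fmove;
     V := fun p y => exists w s, realizes y w s /\ V M p w |}.

Lemma fle_extend y z w s : fle y z -> realizes y w s ->
  exists w' q, realizes z w' (q ++ s) /\ le M w w'.
Proof.
move=> /suffixP[p Ep] [ws ys]; have [w1 [s1 [ws1 zs1]]] := fworld_realized z.
have [|w' [q [wq ww' Eq]]] := @chain_extend w s w1 s1 p ws ws1.
  by rewrite -zs1 Ep ys.
by exists w', q; split=> //; split=> //; rewrite zs1.
Qed.

(** Whatever chain for [y] witnesses the move, [fle_extend] continues it to a chain for [y'], to
    which [move_forward] applies. *)
Lemma fmove_forward y y' z : fle y y' -> fmove y z -> exists2 z', fle z z' & fmove y' z'.
Proof.
move=> yy' [w [s [v [u [t [mv ys zt]]]]]].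
have [ws _ _ _ _] := move_spec mv.
have [w' [q [[wq y'q] _]]] := fle_extend yy' (conj ws ys).
have [v' [u' [t' [mv' st]]]] := move_forward mv wq.
have [_ ut' _ _ _] := move_spec mv'.
have [z' [_ zt']] := fworld_of_chain ut'.
exists z'; first by rewrite /fle zt zt'; case: st => r ->; rewrite map_cat suffix_suffix.
by exists w', (q ++ s), v', u', t'.
Qed.

Lemma fmove_downward y y' z' : fle y y' -> fmove y' z' -> exists2 z, fmove y z & fle z z'.
Proof.
move=> /suffixP[p Ep] [w' [s' [v' [u' [t' [mv ys zt]]]]]].
(* The codes of [s'] are [p] followed by those of [y], so dropping [size p] entries leaves the codes
   of [y]. *)
have Es' : s' = take (size p) s' ++ drop (size p) s' by rewrite cat_take_drop.
have Ey : fcodes y = map c (drop (size p) s') by rewrite map_drop -ys Ep drop_size_cat.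
have [|w [v [u [t [mv' st]]]]] := move_downward mv Es'.
  have [w [s [/chain_head[s0 ->] ws]]] := fworld_realized y.
  by move=> E; move: Ey; rewrite ws E.
have [_ ut _ _ _] := move_spec mv'.
have [z [_ zt']] := fworld_of_chain ut.
exists z; first by exists w, (drop (size p) s'), v, u, t.
by rewrite /fle zt zt'; case: st => r ->; rewrite map_cat suffix_suffix.
Qed.

Lemma fmodel_S4I : S4I_model fmodel.
Proof.
split; last split; [|by move=> y []|split].
- split; first by split=> [y|x y z]; [apply: suffix_refl | apply: suffix_trans].
  split; first by split=> [y|x y z]; [apply: rt_refl | apply: rt_trans].
  split=> //; split=> //; split=> // p y z [w [s [ys Vw]]] yz.
  have [w' [q [zq ww']]] := fle_extend yz ys.
  exists w', (q ++ s); split=> //.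
  by case: HM => [[_ [_ [_ [_ [V_le _]]]]] _]; apply: V_le ww'.
- move=> y y' z yy' yz; elim: yz y' yy' => {y z} [y z yz|y|x y z _ IHx _ IHy] y' yy'.
  + by have [z' zz' y'z'] := fmove_forward yy' yz; exists z'; split=> //; apply: rt_step.
  + by exists y'; split=> //; apply: rt_refl.
  + have [y1 [yy1 y'y1]] := IHx _ yy'; have [z1 [zz1 y1z1]] := IHy _ yy1.
    by exists z1; split=> //; apply: rt_trans y'y1 y1z1.
- move=> y y' z' yy' yz; elim: yz y yy' => {y' z'} [y' z' yz|y'|x' y' z' _ IHx _ IHy] y yy'.
  + by have [z yz' zz'] := fmove_downward yy' yz; exists z; split=> //; apply: rt_step.
  + by exists y; split=> //; apply: rt_refl.
  + have [y1 [yy1 y'y1]] := IHx _ yy'; have [z1 [zz1 y1z1]] := IHy _ y'y1.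
    by exists z1; split=> //; apply: rt_trans yy1 zz1.
Qed.

(** The boxed formula itself travels along the path: at each move it passes along [sq M] by
    transitivity, then to the last world of the target chain by equality of labels. [fsq_Dia] runs
    the same argument backwards. *)
Lemma fsq_Box y z a w s u t : clos_refl_trans _ fmove y z -> Box a \in Sig ->
  realizes y w s -> realizes z u t -> sat M w (Box a) -> sat M u (Box a).
Proof.
move=> yz aS; elim: yz w s u t => {y z} [y z [w1 [s1 [v1 [u1 [t1 [mv ys zt]]]]]]|y|x y z _ IHx _ IHy] w s u t.
- move=> yw zu.
  have [ws1 ut1 wv1 _ luv] := move_spec mv.
  move/(label_sat (realizes_label yw (conj ws1 ys)) aS) => h.
  apply: (label_sat (realizes_label (conj ut1 zt) zu) aS).
  apply: (label_sat (esym luv) aS); apply/(sat_Box _ _ HM) => v v1v.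
  apply: (sat_Box _ _ HM).1 h _ _.
  by case: HM => [[_ [[_ tr] _]] _]; apply: tr v1v.
- by move=> yw yu; apply: label_sat aS; apply: realizes_label yw yu.
- have [v [r yv]] := fworld_realized y.
  by move=> xw zu /(IHx _ _ _ _ xw yv)/(IHy _ _ _ _ yv zu).
Qed.

Lemma fsq_Dia y z a w s u t : clos_refl_trans _ fmove y z -> Dia a \in Sig ->
  realizes y w s -> realizes z u t -> sat M u (Dia a) -> sat M w (Dia a).
Proof.
move=> yz aS; elim: yz w s u t => {y z} [y z [w1 [s1 [v1 [u1 [t1 [mv ys zt]]]]]]|y|x y z _ IHx _ IHy] w s u t.
- move=> yw zu.
  have [ws1 ut1 wv1 _ luv] := move_spec mv.
  move/(label_sat (realizes_label zu (conj ut1 zt)) aS)/(label_sat luv aS).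
  move=> /(sat_Dia _ _ HM)[v v1v va].
  apply: (label_sat (realizes_label (conj ws1 ys) yw) aS).
  apply/(sat_Dia _ _ HM); exists v => //.
  by case: HM => [[_ [[_ tr] _]] _]; apply: tr v1v.
- by move=> yw yu; apply: label_sat aS; apply: realizes_label yu yw.
- have [v [r yv]] := fworld_realized y.
  by move=> xw zu /(IHy _ _ _ _ yv zu)/(IHx _ _ _ _ xw yv).
Qed.

(** The world [v] may itself be dropped from the target chain, so only its label is recovered. *)
Lemma fsq_realize y w s v : realizes y w s -> sq M w v ->
  exists z u t, [/\ clos_refl_trans _ fmove y z, realizes z u t & label u = label v].
Proof.
move=> [ws ys] wv; have [u [t mv]] := move_total ws wv.
have [_ ut _ _ luv] := move_spec mv; have [z zu] := fworld_of_chain ut.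
exists z, u, t; split=> //; apply: rt_step; exists w, s, v, u, t.
by split=> //; case: zu.
Qed.

Lemma fmodel_truth a (y : W fmodel) w s : a \in Sig -> realizes y w s ->
  sat fmodel y a <-> sat M w a.
Proof.
have reflM (v : X) : sq M v v by case: HM => [[_ [[h _] _]] _]; apply: h.
elim: a y w s => [p||a IHa b IHb|a IHa b IHb|a IHa b IHb|a IHa|a IHa] y w s aS yw;
  have := Sig_closed aS.
- move=> _; split=> [[v [t [yv Vv]]]|Vw]; last by exists w, s.
  exact: (label_sat (realizes_label yv yw) aS).
- by split=> //; case: HM => _ [inf _] /inf.
- by move=> [aS1 bS1] /=; rewrite (IHa _ _ _ aS1 yw) (IHb _ _ _ bS1 yw).
- by move=> [aS1 bS1] /=; rewrite (IHa _ _ _ aS1 yw) (IHb _ _ _ bS1 yw).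
- move=> [aS1 bS1]; have biM : is_bi_model M by case: HM.
  split=> [h v wv va|h z yz].
    (* If [v] has the label of [w] it cannot be appended to the chain, but then [y] itself settles
       both subformulas; otherwise [v] extends the chain. *)
    have [e|ne] := pselect (label w = label v).
      apply: (label_sat e bS1); apply/(IHb _ _ _ bS1 yw); apply: h; first exact: suffix_refl.
      by apply/(IHa _ _ _ aS1 yw); apply: label_sat va.
    have [z zv] := fworld_of_chain (chainS yw.1 (conj wv ne)).
    apply/(IHb _ _ _ bS1 zv); apply: h; last exact/(IHa _ _ _ aS1 zv).
    by rewrite /= /fle yw.2 zv.2; apply: (suffix_suffix [:: c v]).
  have [w' [q [zq ww']]] := fle_extend yz yw.
  by move=> /(IHa _ _ _ aS1 zq) wa; apply/(IHb _ _ _ bS1 zq); apply: h.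
- move=> aS1; split=> [h|/(sat_Dia _ _ HM)[v wv va]].
    have [z [yz za]] := h y (suffix_refl _); have [u [t zu]] := fworld_realized z.
    (* Only a path leads from [y] to [z], so [Dia a] is obtained at [u] by reflexivity of [sq M] and
       carried back. *)
    apply: (fsq_Dia yz aS yw zu); apply/(sat_Dia _ _ HM); exists u => //.
    exact/(IHa _ _ _ aS1 zu).
  have [z [u [t [yz zu luv]]]] := fsq_realize yw wv.
  apply/(sat_Dia _ _ fmodel_S4I); exists z => //.
  by apply/(IHa _ _ _ aS1 zu); apply: label_sat va.
- move=> aS1; rewrite (sat_Box _ _ fmodel_S4I); split=> [h|h z yz].
    apply/(sat_Box _ _ HM) => v /(fsq_realize yw)[z [u [t [yz zu luv]]]].
    by apply: (label_sat luv aS1); apply/(IHa _ _ _ aS1 zu); apply: h.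
  have [u [t zu]] := fworld_realized z.
  have /(sat_Box _ _ HM) hu := fsq_Box yz aS yw zu h.
  by apply/(IHa _ _ _ aS1 zu); apply: hu.
Qed.

Lemma fmodel_finite : finite_worlds fmodel.
Proof.
exists (enum fworld) => y; have : y \in enum fworld by rewrite mem_enum.
by elim: (enum _) => //= z l IH; rewrite inE => /orP[/eqP->|/IH]; [left|right].
Qed.

End FiniteModel.

(** * Finite countermodels *)

Lemma S4I_model_finite M phi : S4I_model M -> ~ valid M phi ->
  exists M', S4I_model M' /\ finite_worlds M' /\ ~ valid M' phi.
Proof.
move=> HM nv; have cl := @subforms_closed phi; exists (fmodel M (subforms phi)).
split; first exact: fmodel_S4I; split; first exact: fmodel_finite.
move=> h; apply: nv => w _.
(* Every world of [M] is represented by its one-element chain. *)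
have [y yw] := fworld_of_chain HM (chain1 (subforms phi) w).
by apply/(fmodel_truth HM cl (subforms_refl phi) yw); apply: h.
Qed.

Theorem mainTheorem3 :
  forall phi : form, ~ S4I phi ->
    exists M : model, S4I_model M /\ finite_worlds M /\ ~ valid M phi.
Proof.
by move=> phi /S4I_complete[M [HM nv]]; apply: S4I_model_finite HM nv.
Qed.
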